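(* Let $p\ge5$ be prime. For $k\ge1$ and arbitrary $A,B\in\mathbb{Z}$, put \[ t=\min\left(\left\lfloor\frac{v_p(A)}4\right\rfloor,\left\lfloor\frac{v_p(B)}6\right\rfloor,\left\lfloor\frac{k}6\right\rfloor\right),\quad \ell=k-6t,\quad A_t=A/p^{4t},\quad B_t=B/p^{6t}. \] Then \[ N_k(A,B)=p^{k-1}(p^t-1)+p^{7t}N_\ell(A_t,B_t). \] Moreover, the count on the right is evaluated without another scaling step: if $\ell=0$ it is $1$; if $1\le\ell<6$, then the pair $(A_t,B_t)$ either falls in one of the cases good reduction, node, or terminal cusp, or satisfies $p^4\mid A_t$ and $p^6\mid B_t$, in which case $N_\ell(A_t,B_t)$ is a base value; and if $\ell\ge6$, then $p^4\nmid A_t$ or $p^6\nmid B_t$, so that a scaling step cannot apply and $(A_t,B_t)$ falls in one of the cases good reduction, node, or terminal cusp.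
   Context: $v_p$ is the $p$-adic valuation with $v_p(0)=\infty$, and $\lfloor\infty\rfloor=\infty$ (so $t$ is always finite). For $a,b\in\mathbb{Z}$ and $j\ge1$, $N_j(a,b)=\#\{(x,y)\in(\mathbb{Z}/p^j\mathbb{Z})^2 : y^2\equiv x^3+ax+b\pmod{p^j}\}$, and $N_0(a,b)=1$. Terminology for a pair $(a,b)$ of integers, with $D=4a^3+27b^2$: good reduction means $p\nmid D$; node means $p\mid D$ and $p\nmid a$; terminal cusp means $p\mid a$, $p\mid b$ and not both $v_p(a)\ge4$ and $v_p(b)\ge6$. A scaling step is the identity $N_k(a,b)=(p-1)p^{k-1}+p^7N_{k-6}(a/p^4,b/p^6)$, which is available when $k\ge6$, $p^4\mid a$ and $p^6\mid b$. The base values, for $p^4\mid a$, $p^6\mid b$ and $1\le j<6$, are $N_j(a,b)=(p-1)p^{j-1}+M_j$ with $M_1=1$ and $M_j=p^j$ for $2\le j<6$. *)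

(* Defs.v *)
From mathcomp Require Import all_boot all_order all_algebra.

Set Implicit Arguments.
Unset Strict Implicit.
Unset Printing Implicit Defensive.

Import Order.TTheory GRing.Theory Num.Theory.

(* N_j(a, b).  The case j = 0 is set apart because 'Z_1 is Z/2Z in MathComp;
   for j > 0 and p prime, 'Z_(p ^ j) is the ring Z/p^jZ. *)
Definition npoints (p j : nat) (a b : int) : nat :=
  if j == 0 then 1
  else #|[set xy : 'Z_(p ^ j) * 'Z_(p ^ j) |
           (xy.2 ^+ 2 == xy.1 ^+ 3 + a%:~R * xy.1 + b%:~R)%R]|.

(* Values in {0, 1, 2, ...} together with infinity are encoded in [option nat],
   [None] being infinity (logn p 0 = 0, so logn alone would be wrong at 0). *)
Definition padic_val (p : nat) (a : int) : option nat :=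
  if a == 0%R then None else Some (logn p `|a|%N).

(* floor (v / d), with floor (infinity) = infinity *)
Definition floor_div (v : option nat) (d : nat) : option nat :=
  omap (divn^~ d) v.

(* min (v, m) with m finite *)
Definition min_inf (v : option nat) (m : nat) : nat :=
  if v is Some n then minn n m else m.

(* m <= v *)
Definition leq_inf (m : nat) (v : option nat) : bool :=
  if v is Some n then m <= n else true.

Definition scaling_depth (p k : nat) (A B : int) : nat :=
  min_inf (floor_div (padic_val p A) 4) (min_inf (floor_div (padic_val p B) 6) (k %/ 6)).

Definition discr (a b : int) : int := (4 * a ^+ 3 + 27 * b ^+ 2)%R.

Definition good_reduction (p : nat) (a b : int) : bool :=
  ~~ (p %| discr a b)%Z.

Definition node (p : nat) (a b : int) : bool :=
  (p %| discr a b)%Z && ~~ (p %| a)%Z.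

Definition terminal_cusp (p : nat) (a b : int) : bool :=
  [&& (p %| a)%Z, (p %| b)%Z & ~~ (leq_inf 4 (padic_val p a) && leq_inf 6 (padic_val p b))].

(* The conditions under which the identity
   N_k(a, b) = (p - 1) p^(k - 1) + p^7 N_(k - 6)(a / p^4, b / p^6)
   is available. *)
Definition scaling_step_available (p k : nat) (a b : int) : bool :=
  [&& 6 <= k, ((p ^ 4)%N %| a)%Z & ((p ^ 6)%N %| b)%Z].

(* (p - 1) p^(j - 1) + M_j, meaningful for 1 <= j < 6 *)
Definition base_value (p j : nat) : nat :=
  (p - 1) * p ^ (j - 1) + (if j == 1 then 1 else p ^ j).

(* Main.v *)
Require Import Defs.
From mathcomp Require Import all_boot all_order all_algebra.
From mathcomp Require Import zify ring.

(* Suppose p^4 | a and p^6 | b.  On the points mod p^k with x a unit, the slope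
   y / x is a bijection onto the units, because x + a / x + b / x^2 permutes the
   units; these points account for (p - 1) p^(k - 1).  If p | x, comparing
   valuations in y^2 = x^3 + a x + b alternately improves the divisibility of y
   and x.  For k >= 6 this reaches p^2 | x and p^3 | y, and dividing the equation
   by p^6 leaves the curve (a / p^4, b / p^6) mod p^(k - 6), each of its points
   being hit p^4 p^3 times; for k < 6 it stops earlier, at conditions that
   already force the equation. *)

Set Implicit Arguments.
Unset Strict Implicit.
Unset Printing Implicit Defensive.

Import Order.TTheory GRing.Theory Num.Theory.

(** * Points with invertible x-coordinate over a finite commutative ring *)

Section UnitPoints.

Variables (R : finComUnitRingType) (a b : R).
(** Equivalently, the ideal generated by [a] and [b] lies in the Jacobson radical of [R]. *)
Hypothesis rad_ab : forall c d : R, (1 + a * c + b * d)%R \is a GRing.unit.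

Local Open Scope ring_scope.

Let g (x : R) := x + a * x^-1 + b * x^-1 ^+ 2.

Let g_unit x : x \is a GRing.unit -> g x \is a GRing.unit.
Proof.
move=> Ux; have -> : g x = x * (1 + a * x^-1 ^+ 2 + b * x^-1 ^+ 3).
  rewrite /g; have xK : x * x^-1 = 1 by apply: divrr.
  by ring: xK.
by rewrite unitrM Ux rad_ab.
Qed.

Let g_inj : {in GRing.unit &, injective g}.
Proof.
move=> x z Ux Uz /eqP; rewrite -subr_eq0 => /eqP gE.
have xK : x * x^-1 = 1 by apply: divrr.
have zK : z * z^-1 = 1 by apply: divrr.
(* [e] is the cofactor of [x - z] in [g x - g z]: 1/x - 1/z is -(x - z)/(xz), and 1/x^2 - 1/z^2 is
   this times 1/x + 1/z. It has the shape that [rad_ab] makes a unit. *)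
pose e := 1 + a * - (x^-1 * z^-1) + b * - (x^-1 * z^-1 * (x^-1 + z^-1)).
have : (x - z) * e = 0 by rewrite -gE /e /g; ring: xK zK.
move/(canRL (mulrK (rad_ab _ _)))/eqP.
by rewrite mul0r subr_eq0 => /eqP.
Qed.

(* The slope y / x determines the point: dividing the equation by x ^ 2 gives
   (y / x) ^ 2 = x + a / x + b / x ^ 2, and the right-hand side permutes the
   units. *)
Lemma card_unit_points :
  #|[set xy : R * R | (xy.1 \is a GRing.unit)
       && (xy.2 ^+ 2 == xy.1 ^+ 3 + a * xy.1 + b)]|
  = #|[set x : R | x \is a GRing.unit]|.
Proof.
set S := [set xy | _]; set U := [set x | _].
have gU : g @: U = U.
  apply/eqP; rewrite eqEcard; apply/andP; split.
    by apply/subsetP => _ /imsetP[x + ->]; rewrite !inE; apply: g_unit.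
  by rewrite card_in_imset // => x z; rewrite !inE; apply: g_inj.
pose slope (xy : R * R) := xy.2 / xy.1.
have slopeE xy : xy \in S -> xy.1 \is a GRing.unit /\ slope xy ^+ 2 = g xy.1.
  rewrite inE => /andP[Ux /eqP E]; split=> //.
  rewrite /slope exprMn E /g.
  have xK : xy.1 * xy.1^-1 = 1 by apply: divrr.
  by ring: xK.
suff <- : slope @: S = U.
  rewrite card_in_imset // => xy zw xyS zwS E.
  have [[Ux xE] [Uz zE]] := (slopeE _ xyS, slopeE _ zwS).
  have E1 : xy.1 = zw.1 by apply: g_inj => //; rewrite -xE E zE.
  move: E; rewrite /slope E1 => /(mulIr _) E2.
  by apply: pair_eqP; rewrite /pair_eq E1 E2 ?unitrV ?eqxx.
apply/setP => s; apply/imsetP/idP => [[xy xyS ->]|].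
  have [Ux E] := slopeE _ xyS.
  by rewrite inE -(unitrX_pos _ (isT : (0 < 2)%N)) E g_unit.
rewrite inE => Us.
have : s ^+ 2 \in g @: U by rewrite gU inE unitrX.
case/imsetP => x; rewrite inE => Ux E; exists (x, s * x); last by rewrite /slope /= mulrK.
rewrite inE /= Ux exprMn E /g /=; apply/eqP.
have xK : x * x^-1 = 1 by apply: divrr.
by ring: xK.
Qed.

End UnitPoints.

(** * From points over Z/p^jZ to double sums over natural numbers *)

Lemma sum_periodic (d m : nat) (F : nat -> nat) :
  (forall x, F (m + x) = F x) -> \sum_(x < d * m) F x = d * \sum_(x < m) F x.
Proof.
move=> per; elim: d => [|d IHd]; first by rewrite big_ord0.
rewrite mulSn big_split_ord /= mulSn -IHd; congr (_ + _).
by apply: eq_bigr => x _; apply: per.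
Qed.

Lemma sum_multiples (d m : nat) (F : nat -> nat) :
  0 < d -> \sum_(x < d * m) (d %| x) * F x = \sum_(u < m) F (d * u).
Proof.
case: d => // d _; elim: m => [|m IHm]; first by rewrite muln0 !big_ord0.
rewrite mulnS addnC big_split_ord /= IHm [RHS]big_ord_recr /=; congr (_ + _).
rewrite big_ord_recl /= addn0 dvdn_mulr // mul1n big1 ?addn0 // => i _.
by rewrite /bump /= add1n dvdn_addr ?dvdn_mulr // gtnNdvd // ltnS.
Qed.

(** Natural representatives and integer divisibility allow curves modulo different powers of p to be
    compared without maps between the rings ['Z_n]. *)
Definition cubic_dvd (N : nat) (a b : int) (x y : nat) : bool :=
  (N %| (y%:Z ^+ 2 - (x%:Z ^+ 3 + a * x%:Z + b))%R)%Z.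

Lemma intr_Zp_eq0 (n : nat) (z : int) :
  1 < n -> (z%:~R == 0 :> 'Z_n)%R = (n %| z)%Z.
Proof.
move=> n_gt1; have natE m : (m%:R == 0 :> 'Z_n)%R = (n %| m).
  by rewrite -val_eqE /= val_Zp_nat.
case: z => m; rewrite dvdzE ?NegzE ?mulrNz ?oppr_eq0 ?abszN; exact: natE.
Qed.

Lemma cubic_dvdE (n : nat) (a b : int) (x y : 'Z_n) :
  1 < n ->
  (y ^+ 2 == x ^+ 3 + a%:~R * x + b%:~R)%R = cubic_dvd n a b x y.
Proof.
move=> n_gt1; rewrite /cubic_dvd -intr_Zp_eq0 // -subr_eq0.
by rewrite !(rmorphB, rmorphD, rmorphM, rmorphXn) /= -!pmulrn !natr_Zp.
Qed.

Lemma card_Zp_pairs (n : nat) (P : nat -> nat -> bool) :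
  1 < n ->
  #|[set xy : 'Z_n * 'Z_n | P xy.1 xy.2]| = \sum_(x < n) \sum_(y < n) P x y.
Proof.
move=> n_gt1; rewrite -sum1dep_card big_mkcond /=.
rewrite -(pair_big xpredT xpredT (fun x y : 'Z_n => if P x y then 1 else 0)) /=.
rewrite -[in RHS](Zp_cast n_gt1); apply: eq_bigr => x _; apply: eq_bigr => y _.
by case: (P _ _).
Qed.

Lemma npoints_sum (p j : nat) (a b : int) :
  prime p ->
  npoints p j a b = \sum_(x < p ^ j) \sum_(y < p ^ j) cubic_dvd (p ^ j) a b x y.
Proof.
move=> p_pr; rewrite /npoints; case: eqP => [->|/eqP].
  by rewrite expn0 !big_ord1 /cubic_dvd dvd1z.
rewrite -lt0n => j_gt0.
have n_gt1 : 1 < p ^ j by rewrite -(exp1n j) ltn_exp2r ?prime_gt1.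
rewrite -card_Zp_pairs //; apply: eq_card => xy.
by rewrite !inE cubic_dvdE.
Qed.

(** As p divides [a] and [b], every 1 + a c + b d is 1 modulo p, hence a unit modulo p^j. So
    [card_unit_points] applies, and the count is the totient of p^j. *)
Lemma unit_point_sum (p j : nat) (a b : int) :
  prime p -> 0 < j -> (p %| a)%Z -> (p %| b)%Z ->
  \sum_(x < p ^ j) \sum_(y < p ^ j) (~~ (p %| x) && cubic_dvd (p ^ j) a b x y)
    = (p - 1) * p ^ (j - 1).
Proof.
move=> p_pr j_gt0 pa pb.
have n_gt1 : 1 < p ^ j by rewrite -(exp1n j) ltn_exp2r ?prime_gt1.
have unitE (x : 'Z_(p ^ j)) : (x \is a GRing.unit) = ~~ (p %| x).
  by rewrite -[x in LHS]natr_Zp unitZpE // coprime_pexpl // prime_coprime.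
rewrite -(card_Zp_pairs (fun x y => ~~ (p %| x) && cubic_dvd (p ^ j) a b x y)) //.
have rad (c d : 'Z_(p ^ j)) : (1 + a%:~R * c + b%:~R * d)%R \is a GRing.unit.
  have [z zE] : exists z : int, z = (1 + a * (c : nat)%:Z + b * (d : nat)%:Z)%R.
    by eexists.
  have -> : (1 + a%:~R * c + b%:~R * d = z%:~R)%R.
    by rewrite zE !(rmorphD, rmorphM) /= -!pmulrn !natr_Zp.
  have pz : ~~ (p %| z)%Z.
    rewrite zE -addrA rpredDr ?rpredD ?dvdz_mulr //.
    by rewrite dvdz1 /=; apply: contraTneq p_pr => ->.
  case: z pz {zE} => m; rewrite dvdzE ?NegzE ?abszN /= => pm.
    by rewrite -pmulrn unitZpE // coprime_pexpl // prime_coprime.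
  by rewrite mulrNz unitrN -pmulrn unitZpE // coprime_pexpl // prime_coprime.
have <- : totient (p ^ j) = (p - 1) * p ^ (j - 1) by rewrite totient_pfactor ?subn1.
rewrite -card_units_Zp ?(ltnW n_gt1) // /units_Zp cardsT card_sub.
transitivity #|[set x : 'Z_(p ^ j) | x \is a GRing.unit]|; last first.
  by apply: eq_card => x; rewrite inE.
rewrite -(card_unit_points rad); apply: eq_card => xy.
by rewrite !inE unitE cubic_dvdE.
Qed.

(** * Divisibility of integers by powers of p *)

Lemma dvdz_ppow_le (p e i : nat) (z : int) :
  e <= i -> ((p ^ i)%N %| z)%Z -> ((p ^ e)%N %| z)%Z.
Proof. by move=> le_ei; apply: dvdn_trans; apply: dvdn_exp2l. Qed.

Lemma dvdz_ppowM (p e i n : nat) (z w : int) :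
  e <= i + n -> ((p ^ i)%N %| z)%Z -> ((p ^ n)%N %| w)%Z ->
  ((p ^ e)%N %| (z * w)%R)%Z.
Proof.
move=> le_e pz pw; apply: dvdz_ppow_le le_e _.
by rewrite expnD PoszM dvdz_mul.
Qed.

Lemma dvdz_ppowX (p e i n : nat) (z : int) :
  e <= i * n -> ((p ^ i)%N %| z)%Z -> ((p ^ e)%N %| (z ^+ n)%R)%Z.
Proof.
by move=> le_e pz; apply: dvdz_ppow_le le_e _; rewrite dvdzE abszX expnM dvdn_exp2r.
Qed.

(** For z nonzero and n > 0, n v_p(z) >= m forces v_p(z) >= ceil(m / n); the inequality on [e]
    states e <= ceil(m / n) without a division. *)
Lemma dvdz_ppow_root (p m n e : nat) (z : int) :
  prime p -> n * e < m + n -> ((p ^ m)%N %| (z ^+ n)%R)%Z -> ((p ^ e)%N %| z)%Z.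
Proof.
move=> p_pr le_e; rewrite !dvdzE abszX /=.
have [->|z_neq0] := eqVneq `|z|%N 0; first by rewrite dvdn0.
rewrite -lt0n in z_neq0.
by rewrite !pfactor_dvdn ?expn_gt0 ?z_neq0 // lognX; nia.
Qed.

(** * Valuation descent on the points with p | x *)

Section Descent.

Variables (p : nat) (a b : int).
Hypotheses (p_pr : prime p) (pa : ((p ^ 4)%N %| a)%Z) (pb : ((p ^ 6)%N %| b)%Z).

Lemma cubic_tail_dvd (e i x : nat) :
  e <= 4 + i -> e <= 6 -> p ^ i %| x -> ((p ^ e)%N %| (a * x%:Z + b)%R)%Z.
Proof.
move=> e4 e6 px; apply: rpredD; first exact: dvdz_ppowM e4 pa _.
exact: dvdz_ppow_le e6 _.
Qed.

(** p^e divides the modulus, x^3 and a x + b, hence y^2; [n] is at most e / 2 rounded up. *)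
Lemma cubic_dvd_y (e n i j x y : nat) :
  cubic_dvd (p ^ j) a b x y -> p ^ i %| x ->
  e <= j -> e <= i * 3 -> e <= 4 + i -> e <= 6 -> 2 * n < e + 2 -> p ^ n %| y.
Proof.
move=> xy px ej e3 e4 e6 lt_n; apply: (@dvdz_ppow_root p e 2 n y%:Z) => //.
rewrite -(subrK (x%:Z ^+ 3 + a * x%:Z + b)%R (y%:Z ^+ 2)%R) rpredD //.
  exact: dvdz_ppow_le ej xy.
by rewrite -addrA rpredD ?(cubic_tail_dvd e4) // (dvdz_ppowX e3).
Qed.

Lemma cubic_dvd_x (e n i l j x y : nat) :
  cubic_dvd (p ^ j) a b x y -> p ^ i %| x -> p ^ l %| y ->
  e <= j -> e <= l * 2 -> e <= 4 + i -> e <= 6 -> 3 * n < e + 3 -> p ^ n %| x.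
Proof.
move=> xy px py ej e2 e4 e6 lt_n; apply: (@dvdz_ppow_root p e 3 n x%:Z) => //.
have -> : (x%:Z ^+ 3 = y%:Z ^+ 2 - (y%:Z ^+ 2 - (x%:Z ^+ 3 + a * x%:Z + b))
                       - (a * x%:Z + b))%R by ring.
rewrite rpredB ?(cubic_tail_dvd e4) // rpredB ?(dvdz_ppowX e2) //.
exact: dvdz_ppow_le ej xy.
Qed.

Lemma cubic_dvd_of_dvd (i l j x y : nat) :
  p ^ i %| x -> p ^ l %| y ->
  j <= i * 3 -> j <= l * 2 -> j <= 4 + i -> j <= 6 -> cubic_dvd (p ^ j) a b x y.
Proof.
move=> px py j3 j2 j4 j6; rewrite /cubic_dvd -addrA rpredB ?(dvdz_ppowX j2) //.
by rewrite rpredD ?(cubic_tail_dvd j4) // (dvdz_ppowX j3).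
Qed.

Lemma singular_points_deep (j x y : nat) :
  6 <= j ->
  (p %| x) && cubic_dvd (p ^ j) a b x y
    = [&& p ^ 2 %| x, p ^ 3 %| y & cubic_dvd (p ^ j) a b x y].
Proof.
move=> j6; apply/andP/and3P => [[p1x xy]|[p2x _ ->]]; last first.
  by rewrite (dvdn_trans _ p2x) // dvdn_exp.
rewrite -(expn1 p) in p1x.
(* Three rounds: p^3 | y^2 gives p^2 | y; then p^4 | x^3 gives p^2 | x; then p^5 | y^2 gives p^3 |
   y. *)
have p2y : p ^ 2 %| y by apply: (@cubic_dvd_y 3 2 _ _ _ _ xy p1x); lia.
have p2x : p ^ 2 %| x by apply: (@cubic_dvd_x 4 2 _ _ _ _ _ xy p1x p2y); lia.
by split=> //; apply: (@cubic_dvd_y 5 3 _ _ _ _ xy p2x); lia.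
Qed.

(** The exponents are ceil(j / 3) and ceil(j / 2), the least ones that make x^3 and y^2 vanish
    modulo p^j. For j < 6 the term a x + b vanishes as soon as p | x. *)
Lemma singular_points_shallow (j x y : nat) :
  0 < j < 6 ->
  (p %| x) && cubic_dvd (p ^ j) a b x y
    = (p ^ (if j <= 3 then 1 else 2) %| x)
      && (p ^ (if j <= 2 then 1 else if j <= 4 then 2 else 3) %| y).
Proof.
move=> j_bnd; apply/andP/andP => [[p1x xy]|[px py]]; last first.
  split; last by apply: cubic_dvd_of_dvd px py _ _ _ _; do ?[case: ifP => ?]; lia.
  by apply: dvdn_trans px; case: ifP => _; rewrite dvdn_exp.
rewrite -(expn1 p) in p1x.
have p1y : p ^ 1 %| y by apply: (@cubic_dvd_y 1 1 _ _ _ _ xy p1x); lia.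
case: (leqP j 2) => j2; first by rewrite (leq_trans j2).
have p2y : p ^ 2 %| y by apply: (@cubic_dvd_y 3 2 _ _ _ _ xy p1x); lia.
case: (leqP j 3) => j3; first by rewrite (leq_trans j3).
have p2x : p ^ 2 %| x by apply: (@cubic_dvd_x 4 2 _ _ _ _ _ xy p1x p2y); lia.
case: (leqP j 4) => j4 //.
by split=> //; apply: (@cubic_dvd_y 5 3 _ _ _ _ xy p2x); lia.
Qed.

Lemma npoints_split (j : nat) :
  0 < j ->
  npoints p j a b = (p - 1) * p ^ (j - 1)
    + \sum_(x < p ^ j) \sum_(y < p ^ j) ((p %| x) && cubic_dvd (p ^ j) a b x y).
Proof.
move=> j_gt0; rewrite npoints_sum // -(@unit_point_sum p j a b) //.
- rewrite -big_split; apply: eq_bigr => x _; rewrite -big_split /=.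
  by apply: eq_bigr => y _; case: (p %| x); case: cubic_dvd.
- by apply: dvdn_trans pa; rewrite dvdn_exp.
- by apply: dvdn_trans pb; rewrite dvdn_exp.
Qed.

End Descent.

(** * Base values, the scaling step and its iteration *)

Lemma sum_multiples2 (M N c d m n : nat) (P : nat -> nat -> bool) :
  0 < c -> 0 < d -> M = c * m -> N = d * n ->
  \sum_(x < M) \sum_(y < N) [&& c %| x, d %| y & P x y]
    = \sum_(u < m) \sum_(v < n) P (c * u) (d * v).
Proof.
move=> c_gt0 d_gt0 -> ->.
rewrite -(@sum_multiples c m (fun x => \sum_(v < n) P x (d * v))) //.
apply: eq_bigr => x _; rewrite -(@sum_multiples d n (fun y => P x y)) //.
by rewrite big_distrr; apply: eq_bigr => y _ /=; rewrite !mulnb.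
Qed.

Lemma npoints_base (p j : nat) (a b : int) :
  prime p -> ((p ^ 4)%N %| a)%Z -> ((p ^ 6)%N %| b)%Z -> 0 < j < 6 ->
  npoints p j a b = base_value p j.
Proof.
move=> p_pr pa pb j_bnd; have /andP[j_gt0 j_lt6] := j_bnd.
have p_gt0 := prime_gt0 p_pr.
rewrite (npoints_split p_pr pa pb) // /base_value; congr (_ + _).
pose i := if j <= 3 then 1 else 2.
pose l := if j <= 2 then 1 else if j <= 4 then 2 else 3.
transitivity (\sum_(x < p ^ j) \sum_(y < p ^ j) [&& p ^ i %| x, p ^ l %| y & true]).
  apply: eq_bigr => x _; apply: eq_bigr => y _.
  by rewrite (singular_points_shallow p_pr pa pb) // andbT.
rewrite (@sum_multiples2 _ _ _ _ (p ^ (j - i)) (p ^ (j - l)) (fun _ _ => true)).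
- under eq_bigr do rewrite sum_nat_const card_ord muln1.
  rewrite sum_nat_const card_ord -expnD /i /l.
  (* The exponent is (j - i) + (j - l). Since i + l = j for 2 <= j < 6, it equals j there; for j =
     1, i = l = 1 gives p^0 = 1. *)
  by case: j j_gt0 j_lt6 {j_bnd i l} => [|[|[|[|[|[|j]]]]]].
- by rewrite expn_gt0 p_gt0.
- by rewrite expn_gt0 p_gt0.
- by rewrite -expnD subnKC // /i; case: ifP; lia.
- by rewrite -expnD subnKC // /l; do ?[case: ifP => ?]; lia.
Qed.

Lemma cubic_dvdDl (N : nat) (a b : int) (x y : nat) :
  cubic_dvd N a b (N + x) y = cubic_dvd N a b x y.
Proof.
rewrite /cubic_dvd PoszD; set X := Posz x; set Y := Posz y; set M := Posz N.
have -> : (Y ^+ 2 - ((M + X) ^+ 3 + a * (M + X) + b) =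
           Y ^+ 2 - (X ^+ 3 + a * X + b)
           + - (M ^+ 2 + 3 * M * X + 3 * X ^+ 2 + a) * M)%R by ring.
by rewrite rpredDr // dvdz_mull.
Qed.

Lemma cubic_dvdDr (N : nat) (a b : int) (x y : nat) :
  cubic_dvd N a b x (N + y) = cubic_dvd N a b x y.
Proof.
rewrite /cubic_dvd PoszD; set X := Posz x; set Y := Posz y; set M := Posz N.
have -> : ((M + Y) ^+ 2 - (X ^+ 3 + a * X + b) =
           Y ^+ 2 - (X ^+ 3 + a * X + b) + (M + 2 * Y) * M)%R by ring.
by rewrite rpredDr // dvdz_mull.
Qed.

(** With weights 2, 3, 4, 6 for x, y, a, b the equation is homogeneous of weight 6, so p^6 factors
    out and cancels against the modulus. *)
Lemma cubic_dvd_scale (p k : nat) (a b : int) (x y : nat) :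
  0 < p -> 6 <= k ->
  cubic_dvd (p ^ k) (a * (p ^ 4)%N%:Z)%R (b * (p ^ 6)%N%:Z)%R
      (p ^ 2 * x) (p ^ 3 * y)
    = cubic_dvd (p ^ (k - 6)) a b x y.
Proof.
move=> p_gt0 k6.
have p6_neq0 : Posz (p ^ 6) != 0%R by rewrite eqz_nat -lt0n expn_gt0 p_gt0.
rewrite -{1}(subnKC k6) expnD /cubic_dvd PoszM -[RHS](dvdz_mul2l p6_neq0).
set z := (X in (_ %| X)%Z = _); set w := (X in _ = (_ %| X)%Z).
by have -> : z = w by rewrite /z /w !PoszM; ring.
Qed.

Lemma npoints_step (p k : nat) (a b : int) :
  prime p -> 6 <= k ->
  npoints p k (a * (p ^ 4)%N%:Z)%R (b * (p ^ 6)%N%:Z)%R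
    = (p - 1) * p ^ (k - 1) + p ^ 7 * npoints p (k - 6) a b.
Proof.
move=> p_pr k6; have p_gt0 := prime_gt0 p_pr.
have [pa pb] := (dvdz_mull a (dvdzz (p ^ 4)%N), dvdz_mull b (dvdzz (p ^ 6)%N)).
rewrite (npoints_split p_pr pa pb) ?(leq_trans _ k6) //; congr (_ + _).
under eq_bigr => x _ do under eq_bigr => y _ do
  rewrite (singular_points_deep p_pr pa pb) //.
set P := cubic_dvd _ _ _.
rewrite (@sum_multiples2 _ _ _ _ (p ^ (k - 2)) (p ^ (k - 3)) P) ?expn_gt0 ?p_gt0 //;
  try by rewrite -expnD subnKC // (leq_trans _ k6).
(* The ranges of [u] and [v] consist of p^4 and p^3 full periods of length p^(k - 6); this is the
   source of the factor p^7. *)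
have -> : k - 2 = 4 + (k - 6) by lia.
have -> : k - 3 = 3 + (k - 6) by lia.
under eq_bigr => u _ do under eq_bigr => v _ do rewrite /P cubic_dvd_scale //.
set Q := cubic_dvd _ _ _.
rewrite npoints_sum // -/Q !expnD.
under eq_bigr => u _.
  rewrite (@sum_periodic _ _ (fun v => Q u v)).
    over.
  by move=> v; rewrite /Q cubic_dvdDr.
rewrite -big_distrr /=.
rewrite (@sum_periodic _ _ (fun u => \sum_(v < _) Q u v)).
  by rewrite mulnA -expnD.
by move=> u; apply: eq_bigr => v _; rewrite /Q cubic_dvdDl.
Qed.

(** The unit-point terms telescope: (p - 1) p^(k - 1) + p^k (p^t - 1) = p^(k - 1) (p^(t + 1) -
    1). *)
Lemma npoints_iter_step (p k t : nat) (a b : int) :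
  prime p -> 6 * t <= k ->
  npoints p k (a * (p ^ (4 * t))%N%:Z)%R (b * (p ^ (6 * t))%N%:Z)%R
    = p ^ (k - 1) * (p ^ t - 1) + p ^ (7 * t) * npoints p (k - 6 * t) a b.
Proof.
move=> p_pr; have p_gt0 := prime_gt0 p_pr.
elim: t k => [|t IHt] k le_tk.
  by rewrite !(muln0, expn0, subn0) mul1n !mulr1.
have k6 : 6 <= k by lia.
have scaleS (c : int) m :
    (c * (p ^ (m * t.+1))%N%:Z = c * (p ^ (m * t))%N%:Z * (p ^ m)%N%:Z)%R.
  by rewrite mulnS expnD PoszM; ring.
rewrite !scaleS (mulnS 6) (mulnS 7) (expnD p 7).
rewrite npoints_step // IHt; last by lia.
rewrite subnDA mulnDr addnA !mulnA; congr (_ + _).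
(* For t = 0 the subtraction k - 6 - 1 may be truncated, but its term carries the factor p^0 - 1 =
   0. For t > 0, k >= 12 makes it exact. *)
have [->|t_gt0] := posnP t.
  by rewrite expn0 !muln0 addn0 expn1 mulnC.
have -> : k - 1 = 6 + (k - 6 - 1) by lia.
rewrite (expnS p t) !expnD.
have : 0 < p ^ t by rewrite expn_gt0 p_gt0.
case: (p ^ t) => // m _; case: p p_gt0 {p_pr IHt scaleS} => // q _.
by rewrite !subn1 mulSn addSn /=; ring.
Qed.

(** * Scaling depth and reduction types *)

Lemma leq_inf_padic_val (p m : nat) (a : int) :
  prime p -> leq_inf m (padic_val p a) = ((p ^ m)%N %| a)%Z.
Proof.
move=> p_pr; rewrite /padic_val dvdzE /=; case: eqP => [->|/eqP a_neq0].
  by rewrite dvdn0.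
by rewrite pfactor_dvdn // absz_gt0.
Qed.

(** A minimum is determined by its lower bounds: s = t yields the exactness of the divisions, s = t
    + 1 the maximality of t. *)
Lemma leq_scaling_depth (p k s : nat) (A B : int) :
  prime p ->
  (s <= scaling_depth p k A B)
    = [&& ((p ^ (4 * s))%N %| A)%Z, ((p ^ (6 * s))%N %| B)%Z & 6 * s <= k].
Proof.
move=> p_pr.
have leq_min v m : (s <= min_inf v m) = leq_inf s v && (s <= m).
  by case: v => [n|] //=; rewrite leq_min.
have leq_floor v d : 0 < d -> leq_inf s (floor_div v d) = leq_inf (d * s) v.
  by case: v => [n|] //= d_gt0; rewrite leq_divRL // mulnC.
rewrite /scaling_depth !leq_min !leq_floor // !leq_inf_padic_val //.
by rewrite leq_divRL // [s * 6]mulnC.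
Qed.

Lemma reduction_cases (p : nat) (a b : int) :
  prime p -> 5 <= p ->
  [\/ good_reduction p a b, node p a b, terminal_cusp p a b
    | ((p ^ 4)%N %| a)%Z && ((p ^ 6)%N %| b)%Z].
Proof.
move=> p_pr p5; rewrite /good_reduction /node /terminal_cusp.
case D: (p %| discr a b)%Z; last by constructor 1.
case pa: (p %| a)%Z; last by constructor 2.
have pb : (p %| b)%Z.
  have : (p %| (27 * b ^+ 2)%R)%Z.
    have -> : (27 * b ^+ 2 = discr a b - 4 * a ^+ 3)%R by rewrite /discr; ring.
    by rewrite rpredB // dvdz_mull // dvdz_exp.
  (* Here p >= 5 enters: it excludes p = 3, so p | 27 b^2 gives p | b. *)
  have p3 : ~~ (p %| 27).
    by rewrite (Euclid_dvdX 3 3 p_pr) dvdn_prime2 //; case: eqP p5 => // ->.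
  rewrite !dvdzE abszM abszX /= Euclid_dvdM // Euclid_dvdX //=.
  by rewrite (negPf p3) andbT.
rewrite pb !leq_inf_padic_val //=.
by case: (_ && _); [constructor 4 | constructor 3].
Qed.

(* Both integer divisions below are exact, as p^(4t) | A and p^(6t) | B. *)
Theorem theorem15 (p k : nat) (A B : int) :
  prime p -> 5 <= p -> 1 <= k ->
  let t := scaling_depth p k A B in
  let l := k - 6 * t in
  let At := (A %/ (p ^ (4 * t))%N)%Z in
  let Bt := (B %/ (p ^ (6 * t))%N)%Z in
  [/\ npoints p k A B
        = p ^ (k - 1) * (p ^ t - 1) + p ^ (7 * t) * npoints p l At Bt,
      l = 0 -> npoints p l At Bt = 1,
      1 <= l < 6 ->
        [\/ good_reduction p At Bt, node p At Bt, terminal_cusp p At Bt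
          | [/\ ((p ^ 4)%N %| At)%Z, ((p ^ 6)%N %| Bt)%Z
              & npoints p l At Bt = base_value p l]]
    & 6 <= l ->
        [/\ ~ ((p ^ 4)%N %| At)%Z \/ ~ ((p ^ 6)%N %| Bt)%Z,
            ~ scaling_step_available p l At Bt
          & [\/ good_reduction p At Bt, node p At Bt | terminal_cusp p At Bt]]].
Proof.
move=> p_pr p5 k_gt0 t l At Bt; have p_gt0 := prime_gt0 p_pr.
have /and3P[pA pB le_tk] : [&& ((p ^ (4 * t))%N %| A)%Z,
    ((p ^ (6 * t))%N %| B)%Z & 6 * t <= k] by rewrite -leq_scaling_depth.
have AE : A = (At * (p ^ (4 * t))%N%:Z)%R by rewrite divzK.
have BE : B = (Bt * (p ^ (6 * t))%N%:Z)%R by rewrite divzK.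
have cases := reduction_cases At Bt p_pr p5.
have t_max : 6 <= l -> ((p ^ 4)%N %| At)%Z && ((p ^ 6)%N %| Bt)%Z = false.
  move=> l6; apply/negP => /andP[pAt pBt].
  (* A further scaling step would make t + 1 satisfy all three conditions of [leq_scaling_depth]. *)
  suff : t < t by rewrite ltnn.
  rewrite leq_scaling_depth // (mulnSr 4) (mulnSr 6) !(expnD p (_ * t)) !PoszM.
  apply/and3P; split.
  - by rewrite AE mulrC dvdz_mul.
  - by rewrite BE mulrC dvdz_mul.
  - by rewrite /l in l6; lia.
split.
- by rewrite {1}AE {1}BE npoints_iter_step.
- by move=> ->.
- move=> l_bnd; case: cases => [?|?|?|/andP[pAt pBt]].
  + by constructor 1.
  + by constructor 2.
  + by constructor 3.
  + by constructor 4; split=> //; apply: npoints_base.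
- move=> l6; rewrite t_max // in cases; split.
  + by move: (t_max l6); case: (_ %| At)%Z => [/= ->|_]; [right | left].
  + by rewrite /scaling_step_available l6 t_max.
  + by case: cases => // ?; [constructor 1 | constructor 2 | constructor 3].
Qed.
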